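(* Let $t\geq 2$ be an integer, let $\mathcal{H}=\mathrm{Forb}(K_{2,t})$, and let $q$ be any prime power such that $t-1$ divides $q-1$. Then for all $p\in[0,1]$, $$\mathrm{ed}_{\mathcal{H}}(p)\leq\frac{t-1+p\left(2q^2-q(t-1)-2t\right)}{2(q^2-1)}.$$
   Context: All graphs are finite and simple. $K_{2,t}$ is the complete bipartite graph with parts of sizes $2$ and $t$. For a graph $H$, $\mathrm{Forb}(H)$ is the hereditary property consisting of all graphs with no induced subgraph isomorphic to $H$. For graphs $G,G'$ on the same labeled vertex set, $\mathrm{dist}(G,G')=|E(G)\,\Delta\, E(G')|$; for a hereditary property $\mathcal{H}$ (a set of graphs closed under isomorphism and vertex deletion), $\mathrm{dist}(G,\mathcal{H})=\min\{\mathrm{dist}(G,G'): G'\in\mathcal{H},\ V(G')=V(G)\}$. The edit distance function is $$\mathrm{ed}_{\mathcal{H}}(p)=\lim_{n\to\infty}\max\left\{\mathrm{dist}(G,\mathcal{H}): |V(G)|=n,\ |E(G)|=\left\lfloor p\tbinom n2\right\rfloor\right\}\Big/\tbinom n2,\qquad p\in[0,1].$$ (The limit is known to exist, and the function is known to be continuous and concave.) *)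

(* Defs.v *)
From HB Require Import structures.
From mathcomp Require Import all_boot all_order all_algebra.
From mathcomp Require Import all_classical all_reals all_analysis.

Set Implicit Arguments.
Unset Strict Implicit.
Unset Printing Implicit Defensive.

Import Order.TTheory GRing.Theory Num.Theory.
Import numFieldNormedType.Exports.

(* Labeled simple graphs with vertex type V, as sets of 2-element sets. *)
Record sgraph (V : finType) := SGraph {
  edges : {set {set V}};
  edgesP : [forall e in edges, #|e| == 2] }.

HB.instance Definition _ (V : finType) := [isSub for @edges V].
HB.instance Definition _ (V : finType) := [Finite of sgraph V by <:].

Definition adj (V : finType) (G : sgraph V) : rel V :=
  fun x y => [set x; y]%SET \in edges G.

Definition isomorphic (V W : finType) (G : sgraph V) (H : sgraph W) : Prop :=
  exists2 f : V -> W, bijective f & forall x y, adj H (f x) (f y) = adj G x y.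

Definition induced_edges (V : finType) (G : sgraph V) (S : {set V}) :
    {set {set {x : V | x \in S}}} :=
  [set e : {set {x : V | x \in S}} | [set val x | x in e]%SET \in edges G]%SET.

Lemma induced_edgesP (V : finType) (G : sgraph V) (S : {set V}) :
  [forall e in induced_edges G S, #|e| == 2].
Proof.
apply/forall_inP => e; rewrite inE => He.
by have /forall_inP /(_ _ He) := edgesP G; rewrite card_imset //; exact: val_inj.
Qed.

Definition induced_subgraph (V : finType) (G : sgraph V) (S : {set V}) :
    sgraph {x : V | x \in S} :=
  SGraph (induced_edgesP G S).

Definition Kst_edges (s t : nat) : {set {set 'I_s + 'I_t}} :=
  [set [set inl i; inr j] | i : 'I_s, j : 'I_t]%SET.

Lemma Kst_edgesP (s t : nat) : [forall e in Kst_edges s t, #|e| == 2].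
Proof. by apply/forall_inP => _ /imset2P[i j _ _ ->]; rewrite cards2. Qed.

Definition complete_bipartite (s t : nat) : sgraph ('I_s + 'I_t)%type :=
  SGraph (Kst_edgesP s t).

Definition graph_property := forall V : finType, sgraph V -> Prop.

Definition Forb (W : finType) (H : sgraph W) : graph_property :=
  fun V G => ~ exists S : {set V}, isomorphic (induced_subgraph G S) H.

Definition graph_dist (V : finType) (G G' : sgraph V) : nat :=
  #|(edges G :\: edges G') :|: (edges G' :\: edges G)|.

(* Two graphs on V differ in at most 'C(#|V|, 2) pairs, so the neutral value   *)
(* of this minimum is relevant only if P has no member with vertex set V.      *)
Definition dist_to (P : graph_property) (V : finType) (G : sgraph V) : nat :=
  \big[minn/'C(#|V|, 2)]_(G' : sgraph V | `[< P V G' >]) graph_dist G G'.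

Local Open Scope ring_scope.

Definition max_dist (R : realType) (P : graph_property) (p : R) (n : nat) : nat :=
  \max_(G : sgraph 'I_n | #|edges G|%:Z == Num.floor (p * 'C(n, 2)%:R))
    dist_to P G.

(* limn is total; for hereditary P and 0 <= p <= 1 the limit is known to exist. *)
(* The terms n = 0, 1, where 'C(n, 2) = 0, do not affect it.                    *)
Definition edit_distance (R : realType) (P : graph_property) (p : R) : R :=
  limn (fun n : nat => (max_dist P p n)%:R / 'C(n, 2)%:R : R).

Definition prime_power (q : nat) : Prop :=
  exists r k : nat, [/\ prime r, (0 < k)%N & q = (r ^ k)%N].

(* Main.v *)
(* A template is a finite type K with probability weights w and two disjoint
   symmetric relations, white (no edges allowed) and black (only edges allowed).
   Given a graph G and a map f from its vertices to K, delete the edges of G over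
   white pairs and add the non-edges over black pairs; if H does not fit in the
   template, the result has no induced H. For random f with independent values
   of law w, the expected number of edits is e(G) W + (C(n,2) - e(G)) B, where W
   and B are the weights of white and black, so ed(p) <= p W + (1 - p) B.

   For t = 2 the template of split graphs gives p (1 - p), which lies below the
   claimed line. For t = m + 1 >= 3, let F be the field of order q and U its group
   of m-th roots of unity. Take two copies of the nonzero vectors of F^2 modulo U
   (as in Furedi's K_{2,t}-free graphs), with each class black, with pairs from
   opposite copies whose dot product lies in U unconstrained, and with all other
   pairs white. The unconstrained pairs form a q-regular bipartite graph on
   2 (q^2 - 1) / m classes in which two classes have at most m common
   neighbours. *)
Require Import Defs.
From mathcomp Require Import all_boot all_order all_algebra.
From mathcomp Require Import all_solvable all_field.
From mathcomp Require Import all_classical all_reals all_analysis.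
From mathcomp Require Import ring lra.

Import Order.TTheory GRing.Theory Num.Theory.
Import numFieldNormedType.Exports.
Local Open Scope ring_scope.

(** * Product weights on maps, read as independent random choices *)

Lemma sum_ffun_prod_pair {R : comNzRingType} {V K : finType} (w : K -> R)
    (F : K -> K -> R) (x y : V) :
  \sum_k w k = 1 -> x != y ->
  \sum_(f : {ffun V -> K}) (\prod_v w (f v)) * F (f x) (f y) =
  \sum_a \sum_b w a * w b * F a b.
Proof.
move=> w1 xy.
(* The indicator of [f x = a] and [f y = b] is written as one factor per vertex, so that the sum
   over all maps distributes into a product of sums. *)
pose d (a b : K) v (k : K) : R :=
  if v == x then (k == a)%:R else if v == y then (k == b)%:R else 1.
have yx : (y == x) = false by rewrite eq_sym (negPf xy).
have dprod (G : V -> R) : (forall v, v != x -> v != y -> G v = 1) ->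
    \prod_v G v = G x * G y.
  move=> G1; rewrite (bigD1 x) //= (bigD1 y) /= ?yx // mulrA.
  by rewrite big1 ?mulr1 // => v /andP[vx vy]; exact: G1.
have dE (f : {ffun V -> K}) a b :
    \prod_v d a b v (f v) = (f x == a)%:R * (f y == b)%:R.
  rewrite dprod ?/d ?eqxx ?yx // => v vx vy.
  by rewrite (negPf vx) (negPf vy).
have sumd (k0 : K) (G : K -> R) : \sum_k G k * (k == k0)%:R = G k0.
  rewrite (bigD1 k0) //= eqxx mulr1 big1 ?addr0 // => k /negPf ->.
  by rewrite mulr0.
transitivity (\sum_(f : {ffun V -> K}) \sum_a \sum_b
    (\prod_v (w (f v) * d a b v (f v))) * F a b).
  apply: eq_bigr => f _.
  under [RHS]eq_bigr => a _ do under eq_bigr => b _ do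
    rewrite big_split /= dE.
  rewrite [RHS](bigD1 (f x)) //= [X in _ + X]big1 ?addr0; last first.
    move=> a; rewrite eq_sym => /negPf ax; apply: big1 => b _.
    by rewrite ax !(mulr0, mul0r).
  rewrite (bigD1 (f y)) //= [X in _ + X]big1 ?addr0 ?eqxx ?mulr1 //.
  by move=> b; rewrite eq_sym => /negPf ->; rewrite !(mulr0, mul0r).
rewrite exchange_big; apply: eq_bigr => a _.
rewrite exchange_big; apply: eq_bigr => b _ /=.
rewrite -big_distrl -(bigA_distr_bigA (fun v k => w k * d a b v k)) /=.
congr (_ * _); rewrite dprod; last first.
  move=> v vx vy; rewrite -[RHS]w1; apply: eq_bigr => k _.
  by rewrite /d (negPf vx) (negPf vy) mulr1.
by rewrite /d eqxx yx eqxx !sumd.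
Qed.

(** * Editing a graph along a template *)

Section Template.
Context {V K : finType}.
Implicit Types (r white black : rel K) (f : V -> K) (e : {set V}).

(** Distinct vertices may have the same image, so the diagonal values [r k k] govern the pairs
    inside one class. *)
Definition hits r f e : bool :=
  [exists x in e, exists y in e, (x != y) && r (f x) (f y)].

Lemma hits_pair r f x y : symmetric r -> x != y ->
  hits r f [set x; y]%SET = r (f x) (f y).
Proof.
move=> rC xy; apply/exists_inP/idP => [[u + /exists_inP[v]]|rxy].
  by rewrite !inE => /orP[]/eqP-> /orP[]/eqP->; rewrite ?eqxx //= => /andP[_];
    rewrite // rC.
exists x; rewrite ?set21 //; apply/exists_inP; exists y; rewrite ?set22 //.
by rewrite xy.
Qed.

Definition edited_edges white black f (G : sgraph V) : {set {set V}} :=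
  [set e : {set V} | (#|e| == 2) &&
    (if e \in edges G then ~~ hits white f e else hits black f e)]%SET.

Lemma edited_edgesP white black f (G : sgraph V) :
  [forall e in edited_edges white black f G, #|e| == 2].
Proof. by apply/forall_inP => e; rewrite inE => /andP[]. Qed.

Definition edited white black f (G : sgraph V) : sgraph V :=
  SGraph (edited_edgesP white black f G).

End Template.

Lemma not_Forb_copy {V W : finType} (H : sgraph W) (G : sgraph V) :
  ~ Forb H G ->
  exists2 g : W -> V, injective g & forall u v, adj G (g u) (g v) = adj H u v.
Proof.
move=> /contrapT[S [f [g fK gK] fP]]; exists (val \o g).
  by apply: inj_comp; [exact: val_inj | exact: can_inj gK].
move=> u v; rewrite -[in RHS](gK u) -[in RHS](gK v) fP /adj inE.
by rewrite imsetU !imset_set1.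
Qed.

Definition template_avoids {K W : finType} (white black : rel K)
    (H : sgraph W) : Prop :=
  forall f : W -> K, ~ (forall u v, u != v ->
    if adj H u v then ~~ white (f u) (f v) else ~~ black (f u) (f v)).

Lemma leq_bin2 n : (2 < n)%N -> (n <= 'C(n, 2))%N.
Proof.
case: n => // n n2; rewrite bin2 -divn2 leq_divRL //=.
by rewrite leq_mul2l /=.
Qed.

(** * From template densities to the edit distance *)

Section Bound.
Context {K W : finType} (white black : rel K) (H : sgraph W).
Hypotheses (whiteC : symmetric white) (blackC : symmetric black).
Hypothesis white_black : forall a b, ~~ (white a b && black a b).
Hypothesis avoidH : template_avoids white black H.

(** An induced copy of [H] composed with [f] would be a map excluded by [avoidH]; by disjointness,
    an edit made for one colour does not violate the other. *)
Lemma edited_Forb (V : finType) (f : V -> K) (G : sgraph V) :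
  Forb H (edited white black f G).
Proof.
apply: contrapT => /not_Forb_copy[g g_inj gP]; apply: (avoidH (f \o g)).
move=> u v uv; rewrite -gP /adj inE /=.
have guv : g u != g v by rewrite (inj_eq g_inj).
rewrite cards2 guv /= !hits_pair //.
have := white_black (f (g u)) (f (g v)).
by case: (_ \in edges G); case: (white _ _); case: (black _ _).
Qed.

Lemma dist_to_Forb_le (V : finType) (f : V -> K) (G : sgraph V) :
  (dist_to (Forb H) G <= graph_dist G (edited white black f G))%N.
Proof.
rewrite /dist_to -leEnat -minEnat; apply: bigmin_le_cond.
by apply/asboolP; exact: edited_Forb.
Qed.

Context {R : realType} (w : K -> R).
Hypotheses (w_ge0 : forall k, 0 <= w k) (w_sum1 : \sum_k w k = 1).

Definition density (r : rel K) : R := \sum_a \sum_b w a * w b * (r a b)%:R.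

Lemma density_ge0 r : 0 <= density r.
Proof. by do 2![apply: sumr_ge0 => ? _]; rewrite !mulr_ge0. Qed.

Let E (V : finType) (X : {ffun V -> K} -> R) : R :=
  \sum_(f : {ffun V -> K}) (\prod_v w (f v)) * X f.

Lemma hits_density (V : finType) (r : rel K) (e : {set V}) :
  symmetric r -> #|e| = 2 -> E V (fun f => (hits r f e)%:R) = density r.
Proof.
move=> rC /eqP/cards2P[x [y [xy ->]]].
apply: eq_trans (sum_ffun_prod_pair w (fun a b => (r a b)%:R) x y w_sum1 xy).
by apply: eq_bigr => f _; rewrite hits_pair.
Qed.

Lemma prod_weights_sum1 (V : finType) :
  \sum_(f : {ffun V -> K}) \prod_v w (f v) = 1.
Proof.
rewrite -(bigA_distr_bigA (fun _ k => w k)) /=.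
by rewrite big1 // => v _; rewrite w_sum1.
Qed.

Lemma graph_dist_edited (V : finType) (f : V -> K) (G : sgraph V) :
  (graph_dist G (edited white black f G))%:R =
  \sum_(e : {set V} | #|e| == 2)
    (if e \in edges G then hits white f e else hits black f e)%:R :> R.
Proof.
rewrite -natr_sum -big_mkcondr /= sum1_card; congr (_%:R).
apply: eq_card => e; rewrite !inE /= [RHS]inE.
case: (boolP (e \in edges G)) => [eG|_] /=; last by rewrite andbF.
by rewrite (forall_inP (edgesP G) _ eG) /= negbK andbT orbF.
Qed.

Lemma dist_to_le_density (V : finType) (G : sgraph V) :
  (dist_to (Forb H) G)%:R <=
  #|edges G|%:R * density white + ('C(#|V|, 2) - #|edges G|)%:R * density black.
Proof.
(* The distance, a constant, equals its mean over random [f], so the pointwise bound by the number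
   of edits can be averaged. *)
have -> : (dist_to (Forb H) G)%:R = E V (fun=> (dist_to (Forb H) G)%:R).
  by rewrite /E -big_distrl /= prod_weights_sum1 mul1r.
have edges2 e : e \in edges G -> #|e| == 2 by exact: (forall_inP (edgesP G)).
have -> : 'C(#|V|, 2) = #|[set e : {set V} | #|e| == 2]%SET|.
  by rewrite card_draws.
have sub : edges G \subset [set e : {set V} | #|e| == 2]%SET.
  by apply/fintype.subsetP => e /edges2; rewrite inE.
rewrite -(cardsDS sub).
rewrite !mulr_natl -!sumr_const.
apply: le_trans (_ : E V (fun f => (graph_dist G (edited white black f G))%:R) <= _).
  apply: ler_sum => f _; rewrite ler_wpM2l ?prodr_ge0 // ler_nat.
  exact: dist_to_Forb_le.
rewrite /E; under eq_bigr => f _ do rewrite graph_dist_edited big_distrr.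
rewrite exchange_big /= (bigID (mem (edges G))) /= lerD //.
  rewrite le_eqVlt; apply/orP; left; apply/eqP.
  apply: eq_big => [e|e /andP[/eqP e2 eG]].
    by rewrite andb_idl // => /edges2.
  by rewrite -(hits_density V white e whiteC e2) /E eG.
rewrite le_eqVlt; apply/orP; left; apply/eqP.
apply: eq_big => [e|e /andP[/eqP e2 /negPf eG]]; first by rewrite !inE andbC.
by rewrite -(hits_density V black e blackC e2) /E eG.
Qed.

Context (p : R).
Hypotheses (p_ge0 : 0 <= p) (p_le1 : p <= 1).

(** Because of the floor, the number of edges may fall short of [p * 'C(n, 2)] by less than 1; the
    additive [density black] pays for the surplus of non-edges. *)
Lemma max_dist_le_density n :
  (max_dist (Forb H) p n)%:R <=
  'C(n, 2)%:R * (p * density white + (1 - p) * density black) + density black.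
Proof.
have C0 : 0 <= 'C(n, 2)%:R :> R by [].
have W0 := density_ge0 white; have B0 := density_ge0 black.
apply: (big_ind (fun m => m%:R <= _)) => [|a b|G /eqP eG].
- by rewrite addr_ge0 // mulr_ge0 // addr_ge0 // mulr_ge0 // subr_ge0.
- by rewrite /maxn; case: ifP.
apply: le_trans (dist_to_le_density _ G) _; rewrite card_ord.
have /andP[lo] := floor_itv (p * 'C(n, 2)%:R).
rewrite intrD => hi.
move: lo hi; rewrite -eG -!pmulrn => lo hi.
have eC : (#|edges G| <= 'C(n, 2))%N.
  by rewrite -(ler_nat R) (le_trans lo) // ler_piMl.
rewrite natrB //.
set c := 'C(n, 2)%:R in lo hi C0 *; set e := #|edges G|%:R in lo hi *.
(* The two sides of the goal differ by exactly the sum of this product and the next. *)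
have : 0 <= (p * c - e) * density white by rewrite mulr_ge0 // subr_ge0.
have : 0 <= (e + 1 - p * c) * density black by rewrite mulr_ge0 // subr_ge0 ltW.
nra.
Qed.

Theorem edit_distance_Forb_le :
  edit_distance (Forb H) p <= p * density white + (1 - p) * density black.
Proof.
have W0 := density_ge0 white; have B0 := density_ge0 black.
rewrite /edit_distance; set u := (fun n : nat => _).
(* If the sequence diverged, its [limn] would be the junk value 0. *)
have [cu|/dvgP ->] := pselect (cvgn u); last first.
  by rewrite addr_ge0 // mulr_ge0 // subr_ge0.
apply/ler_addgt0Pr => eps eps0; apply: limr_le => //.
near=> n.
have Cn : (n <= 'C(n, 2))%N.
  by apply: leq_bin2; near: n; exact: nbhs_infty_ge.
(* Since [n <= 'C(n, 2)], this keeps the floor error [density black / 'C(n, 2)] below [eps]. *)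
have n_gt : density black / eps < n%:R by near: n; exact: nbhs_infty_gtr.
have C0 : 0 < 'C(n, 2)%:R :> R.
  rewrite (lt_le_trans _ (_ : n%:R <= _)) ?ler_nat //.
  by rewrite (le_lt_trans _ n_gt) // divr_ge0 // ltW.
rewrite /u ler_pdivrMr //; apply: le_trans (max_dist_le_density n) _.
rewrite [leRHS]mulrC [leRHS]mulrDr lerD2l -ler_pdivrMr // ltW //.
by rewrite (lt_le_trans n_gt) // ler_nat.
Unshelve. all: by end_near.
Qed.

End Bound.

(** * Complete bipartite graphs and the split template *)

Lemma adj_bipartite {s t : nat} (u v : 'I_s + 'I_t) :
  adj (complete_bipartite s t) u v =
  match u, v with inl _, inr _ | inr _, inl _ => true | _, _ => false end.
Proof.
have key (i : 'I_s) (j : 'I_t) :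
    adj (complete_bipartite s t) (inl i) (inr j) by apply/imset2P; exists i j.
case: u v => [i|j] [i'|j'].
- apply/negP => /imset2P[a b _ _ /setP/(_ (inr b))].
  by rewrite !inE eqxx orbT.
- exact: key.
- by rewrite /adj finset.setUC; exact: key.
- apply/negP => /imset2P[a b _ _ /setP/(_ (inl a))].
  by rewrite !inE eqxx.
Qed.

Lemma template_avoids_bipartite {K : finType} {s t : nat} (white black : rel K) :
  (forall (a : 'I_s -> K) (b : 'I_t -> K),
     (forall i i', i != i' -> ~~ black (a i) (a i')) ->
     (forall j j', j != j' -> ~~ black (b j) (b j')) ->
     (forall i j, ~~ white (a i) (b j)) -> False) ->
  template_avoids white black (complete_bipartite s t).
Proof.
move=> noab f fP; apply: (noab (f \o inl) (f \o inr)) => [i i' ii'|j j' jj'|i j].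
- by have := fP (inl i) (inl i'); rewrite adj_bipartite; apply.
- by have := fP (inr j) (inr j'); rewrite adj_bipartite; apply.
- by have := fP (inl i) (inr j); rewrite adj_bipartite; apply.
Qed.

(* A K_{2,t} is not a split graph; the clique side has weight [p]. *)
Lemma edit_distance_K2t_split (R : realType) (t : nat) (p : R) :
  (1 < t)%N -> 0 <= p -> p <= 1 ->
  edit_distance (Forb (complete_bipartite 2 t)) p <= p * (1 - p).
Proof.
case: t => [|[|t]] // _ p0 p1.
pose white (a b : bool) := ~~ a && ~~ b; pose black (a b : bool) := a && b.
pose w (b : bool) := if b then p else 1 - p.
have avoid : template_avoids white black (complete_bipartite 2 t.+2).
  apply: template_avoids_bipartite => a b a_ b_ ab_.
  (* Two vertices of each side suffice: neither pair lies entirely in the clique [true], so each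
     side has a vertex in [false], and these two form a white cross pair. *)
  have := (a_ ord0 ord_max isT, b_ ord0 ord_max isT, ab_ ord0 ord0,
    ab_ ord0 ord_max, ab_ ord_max ord0, ab_ ord_max ord_max).
  rewrite /white /black.
  by case: (a ord0); case: (a ord_max); case: (b ord0); case: (b ord_max);
    case; do 4?case.
have := @edit_distance_Forb_le _ _ white black (complete_bipartite 2 t.+2).
move=> /(_ _ _ _ avoid R w _ _ p p0 p1) bound.
apply: le_trans (bound _ _ _ _ _) _.
- by move=> [] [].
- by move=> [] [].
- by move=> [] [].
- by move=> [] /=; rewrite ?subr_ge0.
- by rewrite big_bool /= addrC subrK.
rewrite /density !big_bool /=; nra.
Qed.

(** The multiplicative group is cyclic, so a power of a generator is a primitive [m]-th root of
    unity, and its powers are all the solutions. *)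
Lemma card_unity_roots (F : finFieldType) (m : nat) :
  (m %| #|F|.-1)%N -> #|[set x : F | x ^+ m == 1]| = m.
Proof.
move=> m_dvd; have q1 := finNzRing_gt1 F.
have q'0 : (0 < #|F|.-1)%N by rewrite -ltnS prednK // ltnW.
have : has #|F|.-1.-primitive_root (enum [set x : F | x != 0]).
  apply: has_prim_root => //; last 2 first.
  - exact: enum_uniq.
  - by rewrite -cardE cardsE (cardC1 (0 : F)).
  apply/allP => x; rewrite mem_enum inE => x0; rewrite unity_rootE.
  by apply/eqP/(mulfI x0); rewrite -exprS prednK ?expf_card ?mulr1 // ltnW.
move=> /hasP[z _ /dvdn_prim_root/(_ _ m_dvd)]; set y := z ^+ _ => ym.
have -> : [set x : F | x ^+ m == 1] = [set y ^+ i | i : 'I_m]%SET.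
  apply/setP => x; rewrite inE; apply/eqP/imsetP => [/(prim_rootP ym)[i ->]|].
    by exists i.
  by move=> [i _ ->]; rewrite exprAC (prim_expr_order ym) expr1n.
rewrite card_imset ?card_ord // => i j /eqP.
by rewrite (eq_prim_root_expr ym) !modn_small // => /eqP/val_inj.
Qed.

(** * The Furedi template over a finite field *)

Section Furedi.
Context {F : finFieldType} (m : nat).
Hypothesis m_gt0 : (0 < m)%N.
Implicit Types (u v x : F * F) (a b : bool * (F * F)).

Definition dot u v : F := u.1 * v.1 + u.2 * v.2.

Definition scale (h : F) u : F * F := (h * u.1, h * u.2).

(* Instead of forming the quotient of F^2 \ 0 by the m-th roots of unity, the
   template keeps all vectors; a class is then a black clique of m of them, and
   the zero vector gets weight 0. *)
Definition same_class u v : bool := [exists h : F, (h ^+ m == 1) && (v == scale h u)].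

Let root_neq0 (h : F) : h ^+ m = 1 -> h != 0.
Proof. by apply: contra_eq_neq => ->; rewrite expr0n eqn0Ngt m_gt0 eq_sym oner_eq0. Qed.

Lemma same_classP u v :
  reflect (exists2 h : F, h ^+ m = 1 & v = scale h u) (same_class u v).
Proof.
apply: (iffP existsP) => [[h /andP[/eqP h1 /eqP ->]]|[h h1 ->]]; exists h => //.
by rewrite h1 !eqxx.
Qed.

Lemma scale1 u : scale 1 u = u.
Proof. by case: u => *; rewrite /scale /= !mul1r. Qed.

Lemma scaleA g h u : scale g (scale h u) = scale (g * h) u.
Proof. by rewrite /scale /= !mulrA. Qed.

Lemma dotC u v : dot u v = dot v u.
Proof. by rewrite /dot mulrC [X in _ + X]mulrC. Qed.

Lemma same_class_sym : symmetric same_class.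
Proof.
suff imp u v : same_class u v -> same_class v u by move=> u v; apply/idP/idP; exact: imp.
move=> /same_classP[h h1 ->]; apply/same_classP; exists h^-1.
  by rewrite exprVn h1 invr1.
by rewrite scaleA mulVf ?scale1 // root_neq0.
Qed.

Lemma same_class_trans : transitive same_class.
Proof.
move=> v u x /same_classP[h h1 ->] /same_classP[g g1 ->].
by apply/same_classP; exists (g * h); rewrite ?exprMn ?g1 ?h1 ?mul1r ?scaleA.
Qed.

(** If [v] and [v'] are independent, [u' - r u] is orthogonal to both and hence zero. Otherwise
    their determinant [D] vanishes, and pairing with [u] gives the factor between [v'] and [v]. *)
Lemma dot_collinear (u u' v v' : F * F) (r : F) :
  dot u v != 0 -> dot u' v = r * dot u v -> dot u' v' = r * dot u v' ->
  u' = scale r u \/ v' = scale (dot u v' / dot u v) v.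
Proof.
case: u u' v v' => [u1 u2] [w1 w2] [v1 v2] [x1 x2].
rewrite /dot /scale /= => uv0 e e'.
have [D|D] := eqVneq (v1 * x2 - v2 * x1) 0; [right|left].
  congr pair; rewrite mulrAC; apply: (canRL (mulfK uv0)); apply/subr0_eq.
  - by rewrite -[RHS](mulr0 (- u2)) -D; ring.
  - by rewrite -[RHS](mulr0 u1) -D; ring.
congr pair; apply: (mulIf D); apply/subr0_eq.
- transitivity ((w1 * v1 + w2 * v2 - r * (u1 * v1 + u2 * v2)) * x2
    - (w1 * x1 + w2 * x2 - r * (u1 * x1 + u2 * x2)) * v2); first by ring.
  by rewrite e e' !subrr !mul0r subrr.
- transitivity ((w1 * x1 + w2 * x2 - r * (u1 * x1 + u2 * x2)) * v1
    - (w1 * v1 + w2 * v2 - r * (u1 * v1 + u2 * v2)) * x1); first by ring.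
  by rewrite e e' !subrr !mul0r subrr.
Qed.

(** These are the unconstrained pairs. The Boolean names the copy of the plane; the [m]-th power
    makes the condition independent of class representatives. *)
Definition dot_adj a b : bool := (a.1 != b.1) && (dot a.2 b.2 ^+ m == 1).

Definition black a b : bool := (a.1 == b.1) && same_class a.2 b.2.

Definition white a b : bool := ~~ black a b && ~~ dot_adj a b.

Lemma black_sym : symmetric black.
Proof. by move=> a b; rewrite /black eq_sym same_class_sym. Qed.

Lemma white_sym : symmetric white.
Proof. by move=> a b; rewrite /white black_sym /dot_adj eq_sym dotC. Qed.

Lemma black_trans : transitive black.
Proof.
move=> b a c /andP[/eqP ab abc] /andP[/eqP bc bcc].
by rewrite /black ab bc eqxx (same_class_trans _ _ _ abc bcc).
Qed.

Lemma dot_adj_black a b c : dot_adj a b -> dot_adj c b -> a.1 = c.1.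
Proof. by case: a b c => [[] ?] [[] ?] [[] ?] //= /andP[+ _] /andP[+ _]. Qed.

(* If [a] and a common neighbour [b j] were in one class, the other [b j'] and
   [a'] would lie on the side opposite to [a] and form a single class. *)
Lemma Furedi_avoids : (1 < m)%N ->
  template_avoids white black (complete_bipartite 2 m.+1).
Proof.
move=> m_gt1; apply: template_avoids_bipartite => a b aN bN abW.
have ab i j : black (a i) (b j) || dot_adj (a i) (b j).
  by have := abW i j; rewrite /white -negb_or negbK.
have adj_ab i j : dot_adj (a i) (b j).
  have := ab i j; case: (boolP (dot_adj _ _)) => // _; rewrite orbF => aibj.
  have [i' i'i] : exists i', i' != i by exists (lift i ord0); rewrite eq_sym neq_lift.
  (* Two indices besides [j] exist because [m.+1] is at least 3. *)
  have [j' [j'' [j'j j''j j'j'']]] : exists j' j'', [/\ j' != j, j'' != j & j' != j''].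
    have m0 : (0 < m)%N by [].
    exists (lift j (Ordinal m0)), (lift j (Ordinal m_gt1)).
    by split; rewrite ?(inj_eq lift_inj) // eq_sym neq_lift.
  have opp k : k != j -> dot_adj (a i) (b k).
    move=> kj; have := ab i k => /orP[aibk|//]; have := bN _ _ kj.
    by rewrite black_sym (black_trans _ _ _ _ aibk) // black_sym.
  have opp' : dot_adj (a i') (b j).
    have := ab i' j => /orP[ai'bj|//]; have := aN _ _ i'i.
    by rewrite (black_trans _ _ _ ai'bj) // black_sym.
  have same k : k != j -> black (a i') (b k).
    move=> kj; have := ab i' k => /orP[//|ai'bk].
    have /andP[/eqP s _] := aibj; have /andP[/negP[]] := opp'.
    by apply/eqP; rewrite (dot_adj_black _ _ _ ai'bk (opp k kj)) s.
  have := bN _ _ j'j''.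
  by rewrite (black_trans _ _ _ _ (same _ j''j)) // black_sym same.
have dotH i j : dot (a i).2 (b j).2 ^+ m = 1 by have /andP[_ /eqP] := adj_ab i j.
have dot0 i j : dot (a i).2 (b j).2 != 0 by exact: root_neq0 (dotH i j).
(* These [m.+1] ratios are [m]-th roots of unity, so two of them coincide; [dot_collinear] then puts
   either both [a i] or two of the [b j] in one class. *)
pose r j := dot (a ord_max).2 (b j).2 / dot (a ord0).2 (b j).2.
have rH j : r j ^+ m = 1 by rewrite expr_div_n !dotH divr1.
have [r_inj|/injectivePn[j [j' jj' rjj']]] := boolP (injectiveb r).
  have : (size (codom r) <= m)%N.
    apply: max_unity_roots => //; apply/allP => _ /codomP[j ->].
    by rewrite unity_rootE rH.
  by rewrite size_codom card_ord ltnn.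
have rE k : dot (a ord_max).2 (b k).2 = r k * dot (a ord0).2 (b k).2.
  by rewrite divfK.
have side i i' : (a i).1 = (a i').1 := dot_adj_black _ _ _ (adj_ab i j) (adj_ab i' j).
have sideb k k' : (b k).1 = (b k').1.
  have /andP[] := adj_ab ord0 k; have /andP[] := adj_ab ord0 k'.
  by case: (a _).1; case: (b k).1; case: (b k').1.
have [|ac|bc] := dot_collinear _ _ _ (b j').2 _ (dot0 ord0 j) (rE j).
- by rewrite rE rjj'.
- have := aN ord0 ord_max isT; rewrite /black (side _ ord_max) eqxx /=.
  by move=> /same_classP[]; exists (r j).
- have := bN _ _ jj'; rewrite /black (sideb _ j') eqxx /=.
  by move=> /same_classP[]; eexists; last exact: bc; rewrite expr_div_n !dotH divr1.
Qed.

Hypothesis m_dvd : (m %| #|F|.-1)%N.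

(** Multiplication by roots of unity acts freely on nonzero vectors. *)
Lemma card_black a : a.2 != 0 -> #|[set b | black a b]%SET| = m.
Proof.
case: a => s [u1 u2] u0; rewrite -[RHS](card_unity_roots F m m_dvd).
rewrite -(@card_in_imset _ _ (fun h => (s, scale h (u1, u2)))); last first.
  move=> g h _ _ [] /eqP; rewrite -subr_eq0 -mulrBl mulf_eq0 => /orP[|/eqP u10].
    by rewrite subr_eq0 => /eqP.
  move=> /eqP; rewrite -subr_eq0 -mulrBl mulf_eq0 => /orP[|/eqP u20].
    by rewrite subr_eq0 => /eqP.
  by case/eqP: u0; rewrite /= u10 u20.
apply: eq_card => -[s' v]; rewrite inE; apply/idP/imsetP.
  move=> /andP[/= /eqP <- /same_classP[h h1 ->]]; exists h => //.
  by rewrite inE h1.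
move=> [h + [-> ->]]; rewrite inE => /eqP h1.
by rewrite /black eqxx /=; apply/same_classP; exists h.
Qed.

Lemma card_dot_adj a : a.2 != 0 -> #|[set b | dot_adj a b]%SET| = (m * #|F|)%N.
Proof.
case: a => s [u1 u2] /= u0.
(* The coordinate vector [c] is independent of [(u1, u2)], so [T] is a linear bijection that turns
   the dot product into a free coordinate. *)
pose c : F * F := if u1 == 0 then (1, 0) else (0, 1).
pose T v : F * F := (dot (u1, u2) v, dot c v).
have T_inj : injective T.
  move=> [v1 v2] [x1 x2] [e]; rewrite /c /dot /= in e *.
  case: eqVneq => [u10|u10]; rewrite !mul0r !mul1r ?add0r ?addr0 => vx; move: e.
    have u20 : u2 != 0 by apply: contraNneq u0 => u20; rewrite u10 u20.
    by rewrite vx => /addrI/(mulfI u20) ->.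
  by rewrite vx => /addIr/(mulfI u10) ->.
have -> : [set b | dot_adj (s, (u1, u2)) b]%SET =
    [set (~~ s, v) | v in T @^-1: finset.setX [set x : F | x ^+ m == 1]%SET [set: F]%SET]%SET.
  apply/setP => -[s' v]; rewrite inE /dot_adj /=; apply/andP/imsetP.
    move=> [ss' uv]; exists v; first by rewrite !inE uv.
    by congr pair; case: s s' ss' => [] [].
  move=> [x + [-> ->]]; rewrite !inE andbT => ->.
  by split=> //; case: (s).
rewrite card_imset; last by move=> v x [].
rewrite on_card_preimset; last exact/onW_bij/injF_bij.
by rewrite cardsX card_unity_roots // cardsT.
Qed.

(** * Densities under uniform weights on nonzero vectors *)

Context (R : realType).

Let c : R := (2 * (#|F|%:R ^+ 2 - 1))^-1.

Definition unif a : R := if a.2 == 0 then 0 else c.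

Lemma unif_ge0 a : 0 <= unif a.
Proof.
rewrite /unif; case: ifP => // _; rewrite invr_ge0 mulr_ge0 // subr_ge0.
by rewrite exprn_ege1 // ler1n ltnW // finNzRing_gt1.
Qed.

Let c_neq0 : 2 * (#|F|%:R ^+ 2 - 1) != 0 :> R.
Proof.
rewrite mulf_neq0 ?pnatr_eq0 // gt_eqF // subr_gt0 exprn_egt1 //.
by rewrite ltr1n finNzRing_gt1.
Qed.

Lemma sum_unif (P : pred (bool * (F * F))) : (forall a, P a -> a.2 != 0) ->
  \sum_a unif a * (P a)%:R = #|[set a | P a]%SET|%:R * c.
Proof.
move=> P0; rewrite mulr_natl -sumr_const [RHS]big_mkcond /=.
apply: eq_bigr => a _; rewrite inE /unif.
by case: (boolP (P a)) => [/P0/negPf ->|_]; rewrite ?mulr1 ?mulr0.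
Qed.

Lemma unif_sum1 : \sum_a unif a = 1.
Proof.
transitivity (\sum_a unif a * (a.2 != 0)%:R).
  by apply: eq_bigr => a _; rewrite /unif; case: eqP; rewrite ?mulr1 ?mul0r.
rewrite sum_unif //.
have -> : [set a : bool * (F * F) | a.2 != 0]%SET = finset.setX [set: bool]%SET [set~ (0, 0)]%SET.
  by apply/setP => a; rewrite !inE.
rewrite cardsX cardsT card_bool cardsC1 card_prod natrM -subn1 natrB; last first.
  by rewrite muln_gt0 andbb ltnW // finNzRing_gt1.
by rewrite natrM divff.
Qed.

(** Neighbours of a nonzero vector are nonzero, hence of weight [c], so every row that carries
    weight sums to [d * c]. *)
Lemma density_regular (r : rel (bool * (F * F))) (d : nat) :
  (forall a b, a.2 != 0 -> r a b -> b.2 != 0) ->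
  (forall a, a.2 != 0 -> #|[set b | r a b]%SET| = d) ->
  density unif r = d%:R * c.
Proof.
move=> r0 rd; transitivity ((\sum_a unif a) * (d%:R * c)); last first.
  by rewrite unif_sum1 mul1r.
rewrite big_distrl; apply: eq_bigr => a _ /=.
under eq_bigr => b _ do rewrite -mulrA.
rewrite -big_distrr /=; have [a0|a0] := eqVneq a.2 0.
  by rewrite /unif a0 eqxx !mul0r.
by rewrite sum_unif ?rd // => b; exact: r0.
Qed.

Lemma density_black : density unif black = m%:R * c.
Proof.
apply: density_regular card_black => -[s u] [s' v] /= u0.
move=> /andP[_ /same_classP[h /root_neq0 h0 /= ->]].
apply: contraNneq u0; case: u => u1 u2 [] /eqP + /eqP.
by rewrite !mulf_eq0 (negPf h0) => /eqP-> /eqP->.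
Qed.

Lemma density_dot_adj : density unif dot_adj = (m * #|F|)%:R * c.
Proof.
apply: density_regular card_dot_adj => -[s u] [s' v] /= u0.
move=> /andP[_ /= /eqP/root_neq0]; apply: contraNneq => ->.
by rewrite /dot !mulr0 addr0.
Qed.

(** The relations [white], [dot_adj] and [black] partition all pairs, whose total weight is 1. *)
Lemma density_white : density unif white = 1 - m%:R * c - (m * #|F|)%:R * c.
Proof.
rewrite -density_black -density_dot_adj; apply/eqP; rewrite eq_sym !subr_eq; apply/eqP.
transitivity ((\sum_a unif a) * (\sum_b unif b)).
  by rewrite unif_sum1 mulr1.
rewrite big_distrlr /density -!big_split /=; apply: eq_bigr => a _.
rewrite -!big_split /=; apply: eq_bigr => b _; rewrite -!mulrDr /white.
suff -> : (~~ black a b && ~~ dot_adj a b)%:R + (dot_adj a b)%:R + (black a b)%:R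
  = 1 :> R by rewrite mulr1.
have : ~~ (black a b && dot_adj a b).
  by apply/negP => /andP[/andP[/eqP ab _] /andP[/negP[]]]; rewrite ab.
by case: (black a b); case: (dot_adj a b) => //=; rewrite ?addr0 ?add0r.
Qed.

Lemma edit_distance_K2t_Furedi (p : R) : (1 < m)%N -> 0 <= p -> p <= 1 ->
  edit_distance (Forb (complete_bipartite 2 m.+1)) p <=
  (m%:R + p * (2 * #|F|%:R ^+ 2 - #|F|%:R * m%:R - 2 * m.+1%:R))
    / (2 * (#|F|%:R ^+ 2 - 1)).
Proof.
move=> m_gt1 p0 p1.
apply: le_trans (edit_distance_Forb_le white black _ white_sym black_sym _
  (Furedi_avoids m_gt1) unif unif_ge0 unif_sum1 p p0 p1) _.
  by move=> a b; rewrite /white; case: (black a b); rewrite ?andbF.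
rewrite density_white density_black /c le_eqVlt; apply/orP; left; apply/eqP.
rewrite natrM -(addn1 m) natrD; field.
by have := c_neq0; rewrite mulf_eq0 negb_or => /andP[].
Qed.

End Furedi.

Theorem theorem8 (R : realType) (t q : nat) (ht : (2 <= t)%N)
    (hq : prime_power q) (htq : (t - 1 %| q - 1)%N)
    (p : R) (hp0 : 0 <= p) (hp1 : p <= 1) :
  edit_distance (Forb (complete_bipartite 2 t)) p <=
    (t%:R - 1 + p * (2 * q%:R ^+ 2 - q%:R * (t%:R - 1) - 2 * t%:R))
      / (2 * (q%:R ^+ 2 - 1)).
Proof.
case: hq => r [k [r_prime k_gt0 qE]]; move: ht htq.
(* The case [t = 2] is separate: the Furedi bound is proved for [m = t - 1] at least 2. *)
rewrite leq_eqVlt => /predU1P[<- _|].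
  have q2 : (1 < q)%N.
    by rewrite qE (leq_trans (prime_gt1 r_prime)) // -{1}(expn1 r) leq_exp2l ?prime_gt1.
  have {}q2 : 2 <= q%:R :> R by rewrite ler_nat.
  apply: le_trans (edit_distance_K2t_split R 2 p isT hp0 hp1) _.
  have q2_gt0 : 0 < 2 * (q%:R ^+ 2 - 1) :> R by nra.
  (* Multiplying by [4 * A] completes the square in [p]; the remainder
     [4 A - (q + 2)^2 = 7 q^2 - 4 q - 12] is positive for [q >= 2]. *)
  rewrite ler_pdivlMr // -subr_ge0 -(pmulr_rge0 _ (mulr_gt0 (ltr0n R 4) q2_gt0)).
  set A := 2 * _ in q2_gt0 *.
  have -> : 4 * A * (2%:R - 1 + p * (2 * q%:R ^+ 2 - q%:R * (2%:R - 1) - 2 * 2%:R)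
      - p * (1 - p) * A) = (2 * A * p - (q%:R + 2)) ^+ 2 + (4 * A - (q%:R + 2) ^+ 2).
    by rewrite /A; ring.
  by rewrite addr_ge0 ?sqr_ge0 // /A; nra.
case: t => // m m_gt1.
have [F _ FE] := pPrimePowerField r_prime k_gt0.
have m1 : m.+1%:R - 1 = m%:R :> R by rewrite -addn1 natrD addrK.
rewrite qE -FE !subn1 m1 => m_dvd.
by apply: edit_distance_K2t_Furedi => //; exact: ltnW.
Qed.
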